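(* Let $f\in\mathcal{S}_L$ with $\arg\min f\neq\varnothing$, and fix $x^\star\in\arg\min f$. Let $x_0,y_0\in\mathbb{R}^d$ and let $P_0\in\mathbb{R}^{d\times d}$ be diagonal with $P_0\succ0$. Let $\beta:[0,\infty)\to(0,\infty)$ be continuously differentiable and let $\gamma:[0,\infty)\to[0,\infty)$. Let $(x,y,P)$ be a solution on $[0,\infty)$, with $P(t)$ diagonal, of the system $$x'=y-x-\beta P^{-1}\nabla f(x),\qquad y'=-P^{-1}\nabla f(x),\qquad P'=-P+\gamma P^{-1}G^2,\qquad G^2=\mathrm{diag}\big((\partial_1 f(x))^2,\dots,(\partial_d f(x))^2\big),$$ with $x(0)=x_0$, $y(0)=y_0$, $P(0)=P_0$, and assume that for all $t\ge0$ $$P(t)\succ0\qquad\text{and}\qquad \gamma(t)\,\|y(t)-x^\star\|_\infty^2\le 2\beta(t).$$ Define $$\mathcal{E}(t):=f(x(t))-f(x^\star)+\tfrac12\|y(t)-x^\star\|_{P(t)}^2 .$$ Then $$\mathcal{E}(t)\le \mathcal{E}(0)\,e^{-t}\qquad\text{for all }t\ge0.$$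
   Context: $\mathcal{S}_L$ ($L>0$) is the set of differentiable convex functions $f:\mathbb{R}^d\to\mathbb{R}$ whose gradient is $L$-Lipschitz in the Euclidean norm. For a symmetric matrix $A$, $\|x\|_A^2:=\langle Ax,x\rangle$; $A\succ0$ means symmetric positive definite. $\|\cdot\|_\infty$ is the maximum norm on $\mathbb{R}^d$. The $P$-equation preserves the diagonal structure of $P_0$, so $P(t)$ is understood to be a diagonal matrix for all $t$. In the system, $\beta,\gamma$ are evaluated at time $t$. *)

(* Defs.v *)
From mathcomp Require Import all_boot all_order all_algebra.
From mathcomp Require Import all_classical all_reals all_analysis.
Set Implicit Arguments.
Unset Strict Implicit.
Unset Printing Implicit Defensive.
Import Order.TTheory GRing.Theory Num.Theory.
Import numFieldNormedType.Exports.
Local Open Scope classical_set_scope.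
Local Open Scope ring_scope.

(* Points of R^d are column vectors. The library norm [`|v|] on matrices is the
   maximum norm; the Euclidean one is [enorm]. *)

Definition dot (R : realType) (d : nat) (u v : 'cV[R]_d) : R :=
  \sum_(i < d) u i 0 * v i 0.

Definition enorm (R : realType) (d : nat) (v : 'cV[R]_d) : R :=
  Num.sqrt (dot v v).

(* <A v, v>, i.e. the square of the norm induced by A *)
Definition sqnorm_mx (R : realType) (d : nat) (A : 'M[R]_d) (v : 'cV[R]_d) : R :=
  dot (A *m v) v.

Definition posdef_mx (R : realType) (d : nat) (A : 'M[R]_d) : Prop :=
  A^T = A /\ forall v : 'cV[R]_d, v != 0 -> 0 < sqnorm_mx A v.

(* The vector of partial derivatives; meaningful where f is differentiable. *)
Definition grad (R : realType) (d : nat) (f : 'cV[R]_d -> R) (x : 'cV[R]_d) :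
    'cV[R]_d :=
  \col_(i < d) 'D_(delta_mx i 0) f x.

Definition class_S (R : realType) (d : nat) (L : R) : set ('cV[R]_d -> R) :=
  [set f | [/\ forall x, differentiable f x,
               convex_function [set: 'cV[R]_d] f &
               forall x y, enorm (grad f x - grad f y) <= L * enorm (x - y)]].

Definition argmin (R : realType) (d : nat) (f : 'cV[R]_d -> R) : set 'cV[R]_d :=
  [set x | forall y, f x <= f y].

(* [v] is the derivative of [g] at [t] when [g] is regarded as a function on
   [0, +oo[ only: two-sided for t > 0, one-sided at t = 0. The values of [g] at
   negative times play no role. *)
Definition is_derive_ge0 (R : realType) (V : normedModType R) (g : R -> V)
    (t : R) (v : V) : Prop :=
  (s - t)^-1 *: (g s - g t) @[s --> within `[0, +oo[ t^'] --> v.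

Definition C1_ge0 (R : realType) (g : R -> R) : Prop :=
  exists2 g' : R -> R,
    forall t : R, 0 <= t -> is_derive_ge0 (g : R -> R^o) t (g' t) &
    {within `[0, +oo[, continuous g'}.

Definition G2 (R : realType) (d : nat) (f : 'cV[R]_d -> R) (x : 'cV[R]_d) :
    'M[R]_d :=
  diag_mx (\row_(i < d) (grad f x i 0) ^+ 2).

(* Classical solution on [0, +oo[: the equations hold at every t >= 0. *)
Definition is_solution (R : realType) (d : nat) (f : 'cV[R]_d -> R)
    (beta gamma : R -> R) (x0 y0 : 'cV[R]_d) (P0 : 'M[R]_d)
    (x y : R -> 'cV[R]_d) (P : R -> 'M[R]_d) : Prop :=
  [/\ x 0 = x0, y 0 = y0, P 0 = P0 &
   forall t : R, 0 <= t ->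
   [/\ is_derive_ge0 x t
         (y t - x t - beta t *: (invmx (P t) *m grad f (x t))),
       is_derive_ge0 y t (- (invmx (P t) *m grad f (x t))) &
       is_derive_ge0 P t (- P t + gamma t *: (invmx (P t) *m G2 f (x t)))]].

(* Main.v *)
Require Import Defs.
From mathcomp Require Import all_boot all_order all_algebra.
From mathcomp Require Import all_classical all_reals all_analysis.
From mathcomp Require Import ring lra.

(** The quantity [E] is a Lyapunov function with [E' <= - E] along the flow, so
    [E t * expR t] is nonincreasing ([exp_decay]).

    Write [g] for the gradient of [f] at [x], [w = y - xstar], and [p_i] for the
    diagonal entries of [P]. The chain rule gives
      [E' = sum_i g_i (y_i - x_i - beta g_i / p_i)
            + 1/2 sum_i (p_i' w_i^2 + 2 p_i w_i y_i')].
    Inserting [y_i' = - g_i / p_i] and [p_i' = - p_i + gamma g_i^2 / p_i], and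
    bounding [f x - f xstar] by [sum_i g_i (x_i - xstar_i)] with the first-order
    convexity inequality ([convex_grad_le]), the terms of [E' + E] collapse
    coordinate by coordinate to
      [(gamma w_i^2 / 2 - beta) g_i^2 / p_i],
    which is nonpositive because [`|w_i|] is at most the maximum norm of [w]. This is
    [energy_dissipation].

    At time 0 the equations only provide one-sided derivatives, and only
    right-continuity of the energy is needed there
    ([is_derive_ge0_cvg_right]). *)

Set Implicit Arguments.
Unset Strict Implicit.
Unset Printing Implicit Defensive.
Import Order.TTheory GRing.Theory Num.Theory.
Import numFieldNormedType.Exports.
Local Open Scope classical_set_scope.
Local Open Scope ring_scope.

Lemma is_derive_ge0_cvg_right (R : realType) (V : normedModType R) (g : R -> V)
    (t : R) (v : V) :
  0 <= t -> is_derive_ge0 g t v -> g s @[s --> t^'+] --> g t.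
Proof.
move=> t0 gv; apply/subr_cvg0.
have gr : (s - t)^-1 *: (g s - g t) @[s --> t^'+] --> v.
  apply: cvg_trans gv => A /= gA.
  have {}gA : nbhs t (fun s => s != t -> s \in `[0, +oo[ ->
    A ((s - t)^-1 *: (g s - g t))) by exact: gA.
  suff : nbhs t (fun s => t < s -> A ((s - t)^-1 *: (g s - g t))) by [].
  apply: filterS gA => s As ts.
  by apply: As; [rewrite gt_eqF|rewrite in_itv /= andbT (le_trans t0) // ltW].
have st0 : (s - t) @[s --> t^'+] --> (0 : R).
  by apply/subr_cvg0; exact: cvg_within.
(* At [s = t] both sides vanish, so the two functions agree everywhere. *)
have -> : (fun s => g s - g t) =
    (fun s => (s - t) *: ((s - t)^-1 *: (g s - g t))).
  apply/funext => s; have [->|st] := eqVneq s t; first by rewrite !subrr scale0r.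
  by rewrite scalerA divff ?scale1r // subr_eq0.
by rewrite -[0](scale0r v); exact: cvgZ st0 gr.
Qed.

(** At a positive time every nearby time is nonnegative, so the restriction to
    the half-line in [is_derive_ge0] disappears. *)
Lemma is_derive_ge0_interior (R : realType) (V : normedModType R) (g : R -> V)
    (t : R) (v : V) :
  0 < t -> is_derive_ge0 g t v -> is_derive t 1 g v.
Proof.
move=> t0 gv.
have gd : h^-1 *: ((g \o shift t) (h *: 1) - g t) @[h --> 0^'] --> v.
  move=> A /gv gA.
  have {}gA : nbhs t (fun s => s != t -> s \in `[0, +oo[ ->
    A ((s - t)^-1 *: (g s - g t))) by exact: gA.
  suff : nbhs (0 : R) (fun h : R => h != 0 ->
    A (h^-1 *: ((g \o shift t) (h *: 1) - g t))) by [].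
  have : nbhs t (fun s => s != t -> A ((s - t)^-1 *: (g s - g t))).
    apply: filterS2 gA (lt_nbhsr t0) => s + s0 st; apply => //.
    by rewrite in_itv /= ltW.
  rewrite -{1}[t]add0r => /nbhsDl; apply: filterS => h + h0.
  rewrite addrK /= [h%:A]mulr1; apply.
  by apply: contra_neq h0 => ht; rewrite -[h](addrK t) ht subrr.
by apply: DeriveDef; [apply/cvg_ex; exists v|apply: cvg_lim].
Qed.

Lemma derive_dot_grad (R : realType) (d : nat) (f : 'cV[R]_d -> R) (x v : 'cV[R]_d) :
  differentiable f x -> 'D_v f x = dot (grad f x) v.
Proof.
move=> fx; rewrite deriveE // {1}[v]matrix_sum_delta linear_sum /dot.
apply: eq_bigr => i _; rewrite big_ord1 linearZ /= mxE deriveE // mulrC //.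
Qed.

Lemma is_derive_comp_grad (R : realType) (d : nat) (f : 'cV[R]_d -> R)
    (x : R -> 'cV[R]_d) (t : R) (v : 'cV[R]_d) :
  differentiable f (x t) -> is_derive t 1 x v ->
  is_derive t 1 (f \o x) (dot (grad f (x t)) v).
Proof.
move=> fx [/derivable1_diffP dx xv].
have dfx : differentiable (f \o x) t by exact: differentiable_comp.
apply: DeriveDef; first exact/derivable1_diffP.
by rewrite -derive_dot_grad // !deriveE // diff_comp //= -xv deriveE.
Qed.

(** First-order characterisation of convexity: by convexity the difference
    quotients of [f] at [x] in the direction [z - x], for steps [0 < h <= 1],
    are at most [f z - f x], and so is their limit. *)
Lemma convex_grad_le (R : realType) (d : nat) (f : 'cV[R]_d -> R)
    (x z : 'cV[R]_d) :
  convex_function [set: 'cV[R]_d] f -> differentiable f x ->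
  dot (grad f x) (z - x) <= f z - f x.
Proof.
move=> cf fx; rewrite -derive_dot_grad //.
have /cvg_dnbhs_at_right : h^-1 *: ((f \o shift x) (h *: (z - x)) - f x)
  @[h --> 0^'] --> 'D_(z - x) f x by exact: diff_derivable.
move/cvgr_to_le; apply; near=> h.
have h0 : 0 < h by [].
have h1 : h <= 1 by near: h; apply: nbhs_right_le.
have : f (h *: z + (1 - h) *: x) <= h * f z + (1 - h) * f x.
  exact: (cf (Itv01 (ltW h0) h1) z x (mem_setT _) (mem_setT _)).
have -> : h *: z + (1 - h) *: x = h *: (z - x) + x.
  by rewrite scalerBl scale1r scalerBr addrA addrAC.
move=> fzx; rewrite -[_ *: _]/(h^-1 * _) mulrC ler_pdivrMr //; rewrite /=; lra.
Unshelve. all: by end_near. Qed.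

Lemma mul_diag_mxE (R : realType) (d n : nat) (A : 'M[R]_d) (B : 'M[R]_(d, n)) :
  is_diag_mx A -> forall i j, (A *m B) i j = A i i * B i j.
Proof.
move=> /is_diag_mxP Ad i j; rewrite mxE (bigD1 i) //= big1 ?addr0 // => k ki.
by rewrite Ad ?mul0r // eq_sym.
Qed.

Lemma posdef_mx_diag_gt0 (R : realType) (d : nat) (A : 'M[R]_d) :
  posdef_mx A -> forall i, 0 < A i i.
Proof.
move=> [_ Apos] i; have := Apos (delta_mx i 0).
have -> : sqnorm_mx A (delta_mx i 0) = A i i.
  rewrite /sqnorm_mx /dot -colE (bigD1 i) //= big1 ?addr0.
    by rewrite !mxE !eqxx mulr1.
  by move=> k ki; rewrite !mxE (negbTE ki) mulr0.
apply; apply/eqP => /matrixP /(_ i 0) /eqP.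
by rewrite !mxE !eqxx oner_eq0.
Qed.

Lemma sqnorm_diag_mxE (R : realType) (d : nat) (A : 'M[R]_d) (v : 'cV[R]_d) :
  is_diag_mx A -> sqnorm_mx A v = \sum_(i < d) A i i * v i 0 ^+ 2.
Proof.
by move=> Ad; apply: eq_bigr => i _; rewrite mul_diag_mxE // expr2 mulrA.
Qed.

Lemma mul_inv_diag_mxE (R : realType) (d n : nat) (A : 'M[R]_d)
    (B : 'M[R]_(d, n)) :
  is_diag_mx A -> posdef_mx A ->
  forall i j, (invmx A *m B) i j = (A i i)^-1 * B i j.
Proof.
move=> Ad Ap i j; have Ai := posdef_mx_diag_gt0 Ap.
have Au : A \in unitmx.
  rewrite unitmxE det_trig ?is_diag_mx_is_trig // unitfE.
  by apply/prodf_neq0 => k _; rewrite gt_eqF.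
by rewrite -{2}[B](mulKVmx Au) (mul_diag_mxE _ Ad) mulKf // gt_eqF.
Qed.

Lemma coord_le_mx_norm (R : realType) (d : nat) (v : 'cV[R]_d) (i : 'I_d) :
  `|v i 0| <= `|v|.
Proof.
by rewrite {2}/Num.Def.normr /= mx_normrE; exact: (le_bigmax _ _ (i, 0)).
Qed.

(** The differential inequality [E' <= - E] at one instant: the left-hand side is
    the derivative of the energy and the right-hand side is the opposite of the
    energy, both written in coordinates; [dP] and [- Pg] are the velocities of [P] and [y]. *)
Lemma energy_dissipation (R : realType) (d : nat) (f : 'cV[R]_d -> R)
    (xstar x y : 'cV[R]_d) (P dP : 'M[R]_d) (Pg : 'cV[R]_d) (beta gamma : R) :
  differentiable f x -> convex_function [set: 'cV[R]_d] f ->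
  is_diag_mx P -> posdef_mx P -> 0 <= gamma ->
  gamma * `|y - xstar| ^+ 2 <= 2 * beta ->
  Pg = invmx P *m grad f x ->
  dP = - P + gamma *: (invmx P *m G2 f x) ->
  dot (grad f x) (y - x - beta *: Pg) +
    2^-1 * \sum_(i < d) (dP i i * (y i 0 - xstar i 0) ^+ 2 +
                         P i i * (2 * (y i 0 - xstar i 0) * (- Pg) i 0)) <=
  - (f x - f xstar + 2^-1 * \sum_(i < d) P i i * (y i 0 - xstar i 0) ^+ 2).
Proof.
move=> fx cf Pd Pp gamma0 gb PgE dPE; have Pi := posdef_mx_diag_gt0 Pp.
have := convex_grad_le xstar cf fx; set g := grad f x => fgrad.
set S1 := dot g (y - x - _); set S2 := \sum_i _; set S3 := \sum_i (P i i * _).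
(* Convexity replaces [f x - f xstar] by a sum over coordinates, after which
   the inequality holds term by term. *)
suff : S1 + 2^-1 * S2 + 2^-1 * S3 - dot g (xstar - x) <= 0 by lra.
rewrite /S1 /S2 /S3 /dot !mulr_sumr -!big_split /= -sumrB.
apply: sumr_le0 => i _.
have Pgi : Pg i 0 = (P i i)^-1 * g i 0 by rewrite PgE mul_inv_diag_mxE.
have dPi : dP i i = - P i i + gamma * ((P i i)^-1 * g i 0 ^+ 2).
  by rewrite dPE 2!mxE mxE mul_inv_diag_mxE // !mxE eqxx mulr1n.
have wi : gamma * (y i 0 - xstar i 0) ^+ 2 <= 2 * beta.
  apply: le_trans gb; apply: ler_wpM2l => //.
  rewrite -real_normK ?num_real // lerXn2r ?nnegrE //.
  by have := coord_le_mx_norm (y - xstar) i; rewrite !mxE.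
have gE : 'D_(delta_mx i 0) f x = g i 0 by rewrite mxE.
rewrite dPi !mxE Pgi gE.
move: (Pi i) wi; set p := P i i; set w := y i 0 - _ => p0 wi.
rewrite [leLHS](_ : _ =
  2^-1 * (gamma * w ^+ 2 - 2 * beta) * (p^-1 * g i 0 ^+ 2)); last first.
  by rewrite /w; field; rewrite gt_eqF.
apply: mulr_le0_ge0; first by rewrite pmulr_rle0 ?invr_gt0 // subr_le0.
by rewrite mulr_ge0 ?sqr_ge0 // invr_ge0 ltW.
Qed.

Lemma is_derive_coord (R : realType) (m n : nat) (M : R -> 'M[R]_(m, n))
    (t : R) (v : 'M[R]_(m, n)) (i : 'I_m) (j : 'I_n) :
  is_derive t 1 M v -> is_derive t 1 (fun s => M s i j) (v i j).
Proof.
move=> [dM <-]; rewrite derive_mx // mxE; apply: derivableP.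
exact: (derivable_mxP M t 1).1.
Qed.

Lemma is_derive_weighted_sqr (R : realType) (p w : R -> R) (c t dp dw : R) :
  is_derive t 1 p dp -> is_derive t 1 w dw ->
  is_derive t 1 (p * (w - cst c) ^+ 2)
    (dp * (w t - c) ^+ 2 + p t * (2 * (w t - c) * dw)).
Proof.
move=> pd wd; apply: is_derive_eq.
rewrite /GRing.scale /= !fctE subr0; ring.
Qed.

(** A differential form of Gronwall's inequality on the half-line, with the
    derivative required at positive times only. *)
Lemma exp_decay (R : realType) (F dF : R -> R) :
  (forall t : R, 0 < t -> is_derive t 1 F (dF t)) ->
  F s @[s --> 0^'+] --> F 0 ->
  (forall t : R, 0 < t -> dF t <= - F t) ->
  forall t : R, 0 <= t -> F t <= F 0 * expR (- t).
Proof.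
move=> FdF F0 dFle t t0.
pose h : R -> R := F * expR.
have hd (s : R) : 0 < s -> is_derive s 1 h (F s *: expR s + expR s *: dF s).
  by move=> s0; apply: is_deriveM; exact: FdF.
suff : h t <= h 0.
  by rewrite /h /= !fctE expR0 mulr1 expRN ler_pdivlMr ?expR_gt0.
apply: (@ler0_derive1_nincry _ h 0) => //.
- by move=> s; rewrite in_itv /= andbT => /hd[].
- move=> s; rewrite in_itv /= andbT => s0.
  have hds := hd s s0; rewrite derive1E derive_val.
  rewrite -[_ *: _]/(F s * expR s) -[X in _ + X]/(expR s * dF s).
  rewrite mulrC -mulrDr pmulr_rle0 ?expR_gt0 //.
  by have := dFle s s0; lra.
- apply/continuous_within_itvcyP; split.
    move=> s; rewrite in_itv /= andbT => /hd[hs _].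
    exact/differentiable_continuous/derivable1_diffP.
  apply: cvgM => //; apply: cvg_at_right_filter; exact: continuous_expR.
Qed.

Theorem theorem2p1 (R : realType) (d : nat) (L : R) (f : 'cV[R]_d -> R)
    (xstar x0 y0 : 'cV[R]_d) (P0 : 'M[R]_d) (beta gamma : R -> R)
    (x y : R -> 'cV[R]_d) (P : R -> 'M[R]_d) :
  0 < L -> class_S L f ->
  argmin f !=set0 -> argmin f xstar ->
  is_diag_mx P0 -> posdef_mx P0 ->
  (forall t : R, 0 <= t -> 0 < beta t) -> C1_ge0 beta ->
  (forall t : R, 0 <= t -> 0 <= gamma t) ->
  is_solution f beta gamma x0 y0 P0 x y P ->
  (forall t : R, 0 <= t -> is_diag_mx (P t)) ->
  (forall t : R, 0 <= t -> posdef_mx (P t)) ->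
  (forall t : R, 0 <= t -> gamma t * `|y t - xstar| ^+ 2 <= 2 * beta t) ->
  let E (t : R) : R :=
    f (x t) - f xstar + 2^-1 * sqnorm_mx (P t) (y t - xstar) in
  forall t : R, 0 <= t -> E t <= E 0 * expR (- t).
Proof.
move=> _ [fdiff fconv _] _ _ _ _ _ _ gamma0 [_ _ _ sol] Pdiag Ppos gammabeta E.
(* At negative times [P s] may fail to be diagonal; [F] is the energy written
   with the diagonal entries alone, a formula that can be differentiated. *)
pose F (s : R) : R := f (x s) - f xstar +
  2^-1 * \sum_(i < d) P s i i * (y s i 0 - xstar i 0) ^+ 2.
have EF (s : R) : 0 <= s -> E s = F s.
  move=> s0; rewrite /E /F sqnorm_diag_mxE; last exact: Pdiag.
  by congr (_ + _ * _); apply: eq_bigr => i _; rewrite !mxE.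
pose Pg (s : R) := invmx (P s) *m grad f (x s).
pose dP (s : R) := - P s + gamma s *: (invmx (P s) *m G2 f (x s)).
pose dF (s : R) : R := dot (grad f (x s)) (y s - x s - beta s *: Pg s) +
    2^-1 * \sum_(i < d) (dP s i i * (y s i 0 - xstar i 0) ^+ 2 +
      P s i i * (2 * (y s i 0 - xstar i 0) * (- Pg s) i 0)).
move=> t t0; rewrite !EF //; apply: (@exp_decay _ F dF) t t0 => [t t0||t t0].
- have [/(is_derive_ge0_interior t0) dx /(is_derive_ge0_interior t0) dy
    /(is_derive_ge0_interior t0) dPt] := sol t (ltW t0).
  have dfx := is_derive_comp_grad (fdiff (x t)) dx.
  have dyi i := is_derive_coord i 0 dy.
  have dPi i := is_derive_coord i i dPt.
  have -> : F = (f \o x - cst (f xstar)) + 2^-1 *: \sum_(i < d)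
      ((fun s => P s i i) * ((fun s => y s i 0) - cst (xstar i 0)) ^+ 2).
    by apply/funext => s; rewrite /F !fctE fct_sumE.
  have dterm i : is_derive t 1
      ((fun s => P s i i) * ((fun s => y s i 0) - cst (xstar i 0)) ^+ 2)
      (dP t i i * (y t i 0 - xstar i 0) ^+ 2 +
       P t i i * (2 * (y t i 0 - xstar i 0) * (- Pg t) i 0)).
    exact: is_derive_weighted_sqr (dPi i) (dyi i).
  apply: is_derive_eq.
  by rewrite subr0.
- have [/(is_derive_ge0_cvg_right (lexx _)) cx
    /(is_derive_ge0_cvg_right (lexx _)) cy
    /(is_derive_ge0_cvg_right (lexx _)) cP] := sol 0 (lexx _).
  apply: cvgD; first apply: cvgB; last 1 first.
  + apply: cvgMl_tmp; apply: cvg_big => [|i _].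
    * exact: add_continuous.
    * have cPi := cvg_comp _ _ cP (@coord_continuous _ _ _ i i (P 0)).
      have cyi := cvg_comp _ _ cy (@coord_continuous _ _ _ i 0 (y 0)).
      apply: cvgM => //; rewrite expr2; under eq_fun do rewrite expr2.
      by apply: cvgM; apply: cvgB => //; exact: cvg_cst.
  + by apply: continuous_cvg cx; exact: differentiable_continuous.
  + exact: cvg_cst.
- have t0' := ltW t0.
  exact: (energy_dissipation (fdiff (x t)) fconv (Pdiag t t0') (Ppos t t0')
    (gamma0 t t0') (gammabeta t t0')).
Qed.
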